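(* Let $X$ be a Banach space over $\mathbb{K}$ ($\mathbb{K}=\mathbb{R}$ or $\mathbb{C}$). If $T\in GL(X)$ is topologically stable, then $T$ has the shadowing property and the strict periodic shadowing property.
   Context: $\mathbb{N}_0=\{0,1,2,\dots\}$. $GL(X)$ is the set of continuous linear operators on $X$ having a continuous inverse. $T\in GL(X)$ is topologically stable if for every neighborhood $V$ of $0$ in $X$ there is a neighborhood $U$ of $0$ in $X$ such that for every (not necessarily linear) homeomorphism $S:X\to X$ with $Tx-Sx\in U$ for all $x\in X$, there is a continuous map $\phi:X\to X$ with $T\circ\phi=\phi\circ S$ and $\phi(x)-x\in V$ for all $x\in X$. $T$ has the shadowing property if for every neighborhood $V$ of $0$ there is a neighborhood $U$ of $0$ such that for every sequence $(x_j)_{j\in\mathbb{Z}}$ in $X$ with $Tx_j-x_{j+1}\in U$ for all $j\in\mathbb{Z}$ there is $x\in X$ with $x_j-T^jx\in V$ for all $j\in\mathbb{Z}$. $T$ has the strict periodic shadowing property if for every neighborhood $V$ of $0$ there is a neighborhood $U$ of $0$ such that for every periodic sequence $(x_j)_{j\in\mathbb{N}_0}$, of period $k$, with $Tx_j-x_{j+1}\in U$ for all $j\in\mathbb{N}_0$, there is $x\in X$ with $T^kx=x$ and $x_j-T^jx\in V$ for all $j\in\mathbb{N}_0$. *)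

(* Defs.v *)
From mathcomp Require Import all_boot all_order all_algebra.
From mathcomp Require Import all_classical all_reals all_analysis.
From mathcomp Require Import complex.

Set Implicit Arguments.
Unset Strict Implicit.
Unset Printing Implicit Defensive.

Import Order.TTheory GRing.Theory Num.Theory.
Import numFieldNormedType.Exports.

Local Open Scope classical_set_scope.
Local Open Scope ring_scope.

(* The (unique) inverse is carried as data so that negative powers make sense;
   it is automatically linear. *)
Record GL (K : numFieldType) (X : normedModType K) := MkGL {
  GL_op :> {linear X -> X};
  GL_inv : X -> X;
  GL_continuous : continuous GL_op;
  GL_inv_continuous : continuous GL_inv;
  GL_opK : cancel GL_op GL_inv;
  GL_invK : cancel GL_inv GL_op }.

Definition GL_iterz (K : numFieldType) (X : normedModType K) (T : GL X)
    (j : int) : X -> X :=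
  match j with
  | Posz n => iter n T
  | Negz n => iter n.+1 (GL_inv T)
  end.

Definition homeomorphism (X : topologicalType) (S : X -> X) : Prop :=
  continuous S /\
  exists S' : X -> X, [/\ continuous S', cancel S S' & cancel S' S].

Definition topologically_stable (K : numFieldType) (X : normedModType K)
    (T : GL X) : Prop :=
  forall V : set X, nbhs (0 : X) V ->
  exists U : set X, nbhs (0 : X) U /\
    forall S : X -> X, homeomorphism S -> (forall x, U (T x - S x)) ->
    exists phi : X -> X,
      [/\ continuous phi,
          forall x, T (phi x) = phi (S x)
        & forall x, V (phi x - x)].

Definition shadowing_property (K : numFieldType) (X : normedModType K)
    (T : GL X) : Prop :=
  forall V : set X, nbhs (0 : X) V ->
  exists U : set X, nbhs (0 : X) U /\
    forall x_ : int -> X, (forall j : int, U (T (x_ j) - x_ (j + 1))) ->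
    exists x : X, forall j : int, V (x_ j - GL_iterz T j x).

(* The period k is any positive period of the sequence, not necessarily the
   least one; this is immaterial since T^k x = x passes to multiples of k. *)
Definition strict_periodic_shadowing_property (K : numFieldType)
    (X : normedModType K) (T : GL X) : Prop :=
  forall V : set X, nbhs (0 : X) V ->
  exists U : set X, nbhs (0 : X) U /\
    forall (x_ : nat -> X) (k : nat), (0 < k)%N ->
    (forall j : nat, x_ (j + k)%N = x_ j) ->
    (forall j : nat, U (T (x_ j) - x_ j.+1)) ->
    exists x : X, iter k T x = x /\ forall j : nat, V (x_ j - iter j T x).

(* Main.v *)
From HB Require Import structures.
Require Import Defs.
From mathcomp Require Import all_boot all_order all_algebra.
From mathcomp Require Import all_classical all_reals all_analysis.
From mathcomp Require Import complex.
From mathcomp Require Import ring lra.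

Set Implicit Arguments.
Unset Strict Implicit.
Unset Printing Implicit Defensive.

Import Order.TTheory GRing.Theory Num.Theory.
Import numFieldNormedType.Exports.

Local Open Scope classical_set_scope.
Local Open Scope ring_scope.

(**
By linearity, both shadowing properties follow once the equation
[h (s i) - T (h i) = d i] is solvable, with a uniform bound on [h], for every
bounded [d] on an index set with a bijection [s]: integers with the successor,
or a finite cycle. On a finite stretch such a solution comes from stability: a
pseudo-orbit with separated points is a true orbit of a Lipschitz perturbation
of [T] supported near these points, so the conjugacy shadows it. Points of a
pseudo-orbit are separated by superposing a large multiple of an orbit of [T],
which is possible unless [T] is torsion; stability excludes a torsion [T] on a
nonzero space. Averaging finite solutions over long stretches ending at each
index gives an approximate solution on the whole index set, and iterating the
correction of the defect gives an exact one.
*)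

(** * Abstract Banach norms on real vector spaces *)

(* Completeness is only ever used through geometrically convergent sequences. *)
Record banach_norm (R : realType) (V : lmodType R) := BanachNorm {
  bnorm :> V -> R;
  bnormD : forall x y, bnorm (x + y) <= bnorm x + bnorm y;
  bnormZ : forall a x, bnorm (a *: x) = `|a| * bnorm x;
  bnorm_eq0 : forall x, bnorm x = 0 -> x = 0;
  bnorm_complete : forall (u : nat -> V) (C : R),
    (forall n, bnorm (u n.+1 - u n) <= C / 2 ^+ n) ->
    exists l, forall n, bnorm (l - u n) <= C *+ 2 / 2 ^+ n }.

(** If [a] were positive, [C / a] would bound every power of 2. This turns geometrically decaying
    error bounds into exact equations. *)
Lemma le0_geometric (R : realType) (a C : R) :
  (forall n, a <= C / 2 ^+ n) -> a <= 0.
Proof.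
move=> aC; rewrite leNgt; apply/negP => a_gt0.
pose n := Num.bound `|C / a|; have := aC n.
have Cn : C / a < 2 ^+ n.
  apply: le_lt_trans (ler_norm _) (lt_trans (archi_boundP (normr_ge0 _)) _).
  by rewrite -natrX ltr_nat ltn_expl.
rewrite ltr_pdivrMr // in Cn.
rewrite ler_pdivlMr ?exprn_gt0 // => aCn.
by move: (le_lt_trans aCn Cn); rewrite mulrC ltxx.
Qed.

Section BanachNormTheory.
Context (R : realType) (V : lmodType R) (N : banach_norm V).

Lemma bnorm0 : N 0 = 0.
Proof. by rewrite -(scale0r (0 : V)) bnormZ normr0 mul0r. Qed.

Lemma bnormN x : N (- x) = N x.
Proof. by rewrite -scaleN1r bnormZ normrN1 mul1r. Qed.

Lemma bnorm_distC x y : N (x - y) = N (y - x).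
Proof. by rewrite -opprB bnormN. Qed.

Lemma bnorm_ge0 x : 0 <= N x.
Proof.
have := bnormD N x (- x); rewrite subrr bnorm0 bnormN; lra.
Qed.

Lemma bnorm_gt0 x : x != 0 -> 0 < N x.
Proof.
move=> x0; rewrite lt_def bnorm_ge0 andbT.
by apply: contra x0 => /eqP/bnorm_eq0 ->.
Qed.

Lemma bnormB x y : N (x - y) <= N x + N y.
Proof. by rewrite -(bnormN y) bnormD. Qed.

Lemma bnorm_distD z x y : N (x - y) <= N (x - z) + N (z - y).
Proof. by rewrite -{1}(subrK z x) -addrA bnormD. Qed.

Lemma bnorm_subD x y : N x <= N (x - y) + N y.
Proof. by rewrite -{1}(subrK y x) bnormD. Qed.

Lemma ler_dist_bnorm x y : `|N x - N y| <= N (x - y).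
Proof.
rewrite ler_norml; have := bnorm_subD x y; have := bnorm_subD y x.
by rewrite bnorm_distC => ? ?; apply/andP; split; lra.
Qed.

Lemma bnorm_sum (I : Type) (r : seq I) (P : pred I) (F : I -> V) :
  N (\sum_(i <- r | P i) F i) <= \sum_(i <- r | P i) N (F i).
Proof.
elim/big_rec2: _ => [|i a x _ ax]; first by rewrite bnorm0.
by apply: le_trans (bnormD _ _ _) _; rewrite lerD2l.
Qed.

(** * Lipschitz perturbations and interpolation by bumps *)

Definition blipschitz (k : R) (f : V -> V) :=
  forall x y, N (f x - f y) <= k * N (x - y).

(* The fixed point of the half-contraction [x |-> T^-1 (y - g x)]. *)
Lemma perturbation_bijective (T : {linear V -> V}) (Ti : V -> V) (B k : R)
    (g : V -> V) :
  cancel Ti T -> 0 < B -> 0 <= k -> (forall x, N x <= B * N (T x)) ->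
  B * k <= 2^-1 -> blipschitz k g ->
  exists S', [/\ cancel (fun x => T x + g x) S',
    cancel S' (fun x => T x + g x) & blipschitz (B *+ 2) S'].
Proof.
move=> TiK B0 k0 TB Bk gk.
(* The expansion rate of [T], at least [1 / B], loses at most half to [g]; this yields both
   injectivity and the Lipschitz bound of the inverse. *)
have expand x y : N (x - y) <= B *+ 2 * N (T x + g x - (T y + g y)).
  have h1 := TB (x - y); rewrite linearB in h1.
  have h2 : N (T x - T y) <=
      N (T x + g x - (T y + g y)) + N (g x - g y).
    have -> : T x - T y = T x + g x - (T y + g y) - (g x - g y).
      by rewrite opprD addrACA addrK.
    exact: bnormB.
  have h3 := gk x y; have h4 := bnorm_ge0 (x - y).
  have h5 : B * N (T x - T y) <=
    B * N (T x + g x - (T y + g y)) + B * (k * N (x - y)).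
    by rewrite -mulrDr ler_pM2l //; lra.
  have h6 : B * k * N (x - y) <= 2^-1 * N (x - y) by rewrite ler_wpM2r.
  rewrite mulr2n mulrDl; lra.
have inj x y : T x + g x = T y + g y -> x = y.
  move=> e; have := expand x y; rewrite e subrr bnorm0 mulr0 => le0.
  by apply/subr0_eq/(bnorm_eq0 (b := N))/le_anti; rewrite le0 bnorm_ge0.
have surj y : exists x, T x + g x = y.
  pose F x := Ti (y - g x).
  have FE x : T (F x) = y - g x by rewrite TiK.
  have Fk x x' : N (F x - F x') <= 2^-1 * N (x - x').
    apply: le_trans (TB _) _; rewrite linearB !FE.
    have -> : y - g x - (y - g x') = - (g x - g x').
      by rewrite !opprB addrC addrA subrK.
    rewrite bnormN; apply: le_trans (_ : B * (k * N (x - x')) <= _).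
      by rewrite ler_pM2l.
    by rewrite mulrA ler_wpM2r // bnorm_ge0.
  pose u n := iter n F 0.
  have uS n : N (u n.+1 - u n) <= N (F 0) / 2 ^+ n.
    elim: n => [|n IH]; first by rewrite /= subr0 expr0 divr1.
    apply: le_trans (Fk _ _) _; rewrite exprS invfM mulrCA ler_pM2l //.
  have [l ul] := bnorm_complete uS.
  exists l; suff Fl : F l = l by rewrite -{1}Fl FE subrK.
  apply/subr0_eq/(bnorm_eq0 (b := N))/le_anti; rewrite bnorm_ge0 andbT.
  apply: (@le0_geometric _ _ (N (F 0) *+ 4)) => n.
  have h := bnorm_distD (u n.+1) (F l) l.
  have h1 := Fk l (u n); have h2 := ul n; have h3 := ul n.+1.
  rewrite bnorm_distC in h3.
  have h4 : N (F 0) *+ 2 / 2 ^+ n.+1 = N (F 0) / 2 ^+ n.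
    by rewrite exprS invfM mulrA -[N _ *+ 2]mulr_natr mulfK ?pnatr_eq0.
  rewrite h4 in h3; have h5 : 0 <= N (F 0) / 2 ^+ n.
    by rewrite divr_ge0 ?bnorm_ge0 ?exprn_ge0.
  have h6 m : N (F 0) *+ m / 2 ^+ n = m%:R * (N (F 0) / 2 ^+ n).
    by rewrite mulrA mulr_natl.
  rewrite !h6 in h2 *; move: h h1 h2 h3; rewrite /= -/(F _).
  set z := N (F 0) / _ in h5 *; lra.
have [S' S'K] := choice surj.
exists S'; split => //; first by move=> x; apply: inj; rewrite S'K.
by move=> x y; rewrite -{2}(S'K x) -{2}(S'K y) expand.
Qed.

(* The bumps live on disjoint balls of radius [1/2] around the points, so at
   most one summand is nonzero at a time; hence a constant independent of [I]. *)
Lemma bump_interpolation (I : finType) (i0 : I) (p d : I -> V) (e : R) :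
  0 <= e -> (forall i, N (d i) <= e) ->
  (forall i j, i != j -> 1 <= N (p i - p j)) ->
  exists g : V -> V, [/\ blipschitz (e *+ 4) g, forall x, N (g x) <= e &
    forall i, g (p i) = d i].
Proof.
move=> e0 de sep.
pose psi i x : R := Num.max 0 (1 - N (x - p i) *+ 2).
have psi_ge0 i x : 0 <= psi i x by rewrite le_max lexx.
have psi_le1 i x : psi i x <= 1.
  by rewrite ge_max ler01 /=; have := bnorm_ge0 (x - p i); lra.
have psi_lip i x y : `|psi i x - psi i y| <= N (x - y) *+ 2.
  have := ler_dist_bnorm (x - p i) (y - p i).
  have -> : x - p i - (y - p i) = x - y by rewrite opprB addrA subrK.
  rewrite !ler_norml => /andP[h1 h2].
  rewrite /psi; case: (leP 0 (1 - N (x - p i) *+ 2)) => ?;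
    case: (leP 0 (1 - N (y - p i) *+ 2)) => ?; apply/andP; split; lra.
have psi_loc x : exists j, forall i, i != j -> psi i x = 0.
  have [[j jx]|nj] := pselect (exists j, N (x - p j) < 2^-1).
    exists j => i ij; have := sep _ _ ij; have := bnorm_distD x (p i) (p j).
    rewrite (bnorm_distC (p i) x) => *; apply/max_idPl; lra.
  (* Outside all the balls every bump vanishes and any index will do. *)
  exists i0 => i _; apply/max_idPl.
  have : ~~ (N (x - p i) < 2^-1) by apply/negP => ?; apply: nj; exists i.
  rewrite -leNgt; lra.
have sum1 (j : I) (c : R) : \sum_i c * (i == j)%:R = c.
  rewrite (bigD1 j) //= eqxx mulr1 big1 ?addr0 // => i /negPf ->.
  by rewrite mulr0.
exists (fun x => \sum_i psi i x *: d i); split.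
- move=> x y; have [jx jxP] := psi_loc x; have [jy jyP] := psi_loc y.
  rewrite -sumrB; apply: le_trans (bnorm_sum _ _ _) _.
  pose c := N (x - y) *+ 2 * e.
  (* Only the bumps at [jx] and [jy] can contribute, each at most [2 e N (x - y)]; hence the
     constant 4. *)
  have -> : e *+ 4 * N (x - y) =
      \sum_i (c * (i == jx)%:R + c * (i == jy)%:R).
    rewrite big_split /= !sum1 /c; lra.
  have c0 : 0 <= c by rewrite mulr_ge0 // mulrn_wge0 // bnorm_ge0.
  apply: ler_sum => i _; rewrite -scalerBl bnormZ.
  have le_c : `|psi i x - psi i y| * N (d i) <= c.
    by rewrite ler_pM // bnorm_ge0.
  case: eqVneq => [_|ix]; case: eqVneq => [_|iy]; rewrite /= ?mulr1 ?mulr0;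
    try lra.
  by rewrite jxP // jyP // subr0 normr0 mul0r addr0.
- move=> x; have [j jP] := psi_loc x.
  apply: le_trans (bnorm_sum _ _ _) _; rewrite -(sum1 j e).
  apply: ler_sum => i _; rewrite bnormZ ger0_norm //.
  case: eqVneq => [_|ij]; last by rewrite jP // mul0r mulr0.
  by rewrite mulr1 -(mul1r e) ler_pM // bnorm_ge0.
- move=> i; rewrite (bigD1 i) //= big1 => [|j ji]; last first.
    rewrite [psi _ _](max_idPl _) ?scale0r //.
    by have := sep _ _ ji; rewrite bnorm_distC; lra.
  by rewrite addr0 [psi _ _](max_idPr _) subrr bnorm0 mul0rn subr0 ?scale1r.
Qed.

End BanachNormTheory.

(** * Shadowing of finite separated pseudo-orbits *)

(* Topological stability restricted to bi-Lipschitz [S] and to the unit ball as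
   [V]; continuity of [phi] is dropped. *)
Definition lipschitz_stable (R : realType) (V : lmodType R)
    (N : banach_norm V) (T : V -> V) :=
  exists2 e : R, 0 < e & forall (S S' : V -> V) (L : R),
    cancel S S' -> cancel S' S -> blipschitz N L S -> blipschitz N L S' ->
    (forall x, N (T x - S x) <= e) ->
    exists phi, (forall x, T (phi x) = phi (S x)) /\
                (forall x, N (phi x - x) <= 1).

Section StableOperator.
Context (R : realType) (V : lmodType R) (N : banach_norm V).
Context (T : {linear V -> V}) (Ti : V -> V) (B : R).
Context (TK : cancel T Ti) (TiK : cancel Ti T) (B_gt0 : 0 < B).
Context (TB : forall x, N (T x) <= B * N x).
Context (TiB : forall x, N x <= B * N (T x)).
Context (Tstab : lipschitz_stable N T).

(** For small [k] the map [x |-> T x + g x] is invertible, Lipschitz in both directions and close to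
    [T], hence an admissible [S]. *)
Lemma stable_conjugacy : exists2 k : R, 0 < k & forall g : V -> V,
  blipschitz N k g -> (forall x, N (g x) <= k) ->
  exists phi, (forall x, T (phi x) = phi (T x + g x)) /\
              (forall x, N (phi x - x) <= 1).
Proof.
case: Tstab => e e0 stab.
have Bi0 : 0 < (B *+ 2)^-1 by rewrite invr_gt0 mulrn_wgt0.
(* The second bound gives [B * k <= 1/2], the half-contraction condition. *)
exists (Num.min e (B *+ 2)^-1); first by rewrite lt_min e0.
set k := Num.min _ _ => g gk gb.
have k0 : 0 <= k by rewrite le_min !ltW.
have [|S' [SK S'K S'l]] :=
    perturbation_bijective TiK B_gt0 k0 TiB _ gk.
  apply: le_trans (_ : B * (B *+ 2)^-1 <= _).
    by rewrite ler_pM2l // ge_min lexx orbT.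
  by rewrite -[B *+ 2]mulr_natr invfM mulrA divff ?mul1r // gt_eqF.
apply: (stab (fun x => T x + g x) S' (Num.max (B + k) (B *+ 2))) => //.
- move=> x y; rewrite opprD addrACA -linearB; apply: le_trans (bnormD _ _ _) _.
  apply: le_trans (_ : (B + k) * N (x - y) <= _); first by rewrite mulrDl lerD.
  by rewrite ler_wpM2r ?bnorm_ge0 // le_max lexx.
- move=> x y; apply: le_trans (S'l _ _) _.
  by rewrite ler_wpM2r ?bnorm_ge0 // le_max lexx orbT.
- move=> x; rewrite opprD addrA subrr add0r bnormN.
  by apply: le_trans (gb x) _; rewrite ge_min lexx.
Qed.

(** Interpolating the errors by bumps makes the pseudo-orbit an exact orbit of [T + g], which [phi]
    maps to an orbit of [T] within distance 1. *)
Lemma separated_shadowing : exists2 e : R, 0 < e & forall n (x : nat -> V),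
  (forall i j, (i < j <= n)%N -> 1 <= N (x i - x j)) ->
  (forall j, (j < n)%N -> N (x j.+1 - T (x j)) <= e) ->
  exists y, forall j, (j <= n)%N -> N (iter j T y - x j) <= 1.
Proof.
have [k k0 conj] := stable_conjugacy.
exists (k / 4); first by rewrite divr_gt0.
move=> n x sep err.
(* The last point has no prescribed image, so its error is set to 0. *)
pose d (i : 'I_n.+1) := if (i < n)%N then x i.+1 - T (x i) else 0.
have dk i : N (d i) <= k / 4.
  by rewrite /d; case: ifP => [/err//|_]; rewrite bnorm0 divr_ge0 ?ltW.
have k40 : 0 <= k / 4 by rewrite divr_ge0 ?ltW.
have [|g [gl gb gd]] := bump_interpolation ord0 k40 dk (p := fun i => x i).
  move=> i j; rewrite neq_ltn => /orP[] ij.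
    by apply: sep; rewrite ij -ltnS ltn_ord.
  by rewrite bnorm_distC; apply: sep; rewrite ij -ltnS ltn_ord.
have [||phi [phiT phi1]] := conj g.
- by rewrite -[k](@divfK _ 4) // mulr_natr.
- by move=> y; apply: le_trans (gb y) _; lra.
have orbit j : (j <= n)%N -> iter j T (phi (x 0)) = phi (x j).
  elim: j => //= j IH jn; rewrite IH ?(ltnW jn) // phiT; congr phi.
  have jn1 : (j < n.+1)%N by rewrite ltnW.
  by rewrite (gd (Ordinal jn1)) /d /= jn addrC subrK.
by exists (phi (x 0)) => j jn; rewrite orbit.
Qed.

(** * Iterates of [T] and the exclusion of torsion *)

Lemma iter_linearD n x y : iter n T (x + y) = iter n T x + iter n T y.
Proof. by elim: n => //= n ->; rewrite linearD. Qed.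

Lemma iter_linearZ n a x : iter n T (a *: x) = a *: iter n T x.
Proof. by elim: n => //= n ->; rewrite linearZ. Qed.

Lemma bnorm_iter n x : N (iter n T x) <= B ^+ n * N x.
Proof.
elim: n => [|n IH]; first by rewrite expr0 mul1r.
by rewrite exprS -mulrA; apply: le_trans (TB _) _; rewrite ler_pM2l.
Qed.

(* For torsion [T] the perturbation [x |-> T x + c T x / (1 + Q x)], with [Q] a
   [T]-invariant equivalent norm, is conjugate to [T] by a bounded
   displacement although all its nonzero orbits are unbounded. *)
Lemma stable_torsion_trivial (m : nat) : (0 < m)%N ->
  (forall x, iter m T x = x) -> forall x : V, x = 0.
Proof.
move=> m_gt0 Tm v; apply/eqP/negPn/negP => v0.
have [k k_gt0 conj] := stable_conjugacy.
(* [Q] sums the norm over one period, so [T] merely permutes its terms. *)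
pose Q x := \sum_(i < m) N (iter i T x).
pose C := \sum_(i < m) B ^+ i.
have C_ge0 : 0 <= C by apply: sumr_ge0 => i _; rewrite exprn_ge0 ?ltW.
have Q_ge0 x : 0 <= Q x by apply: sumr_ge0 => i _; apply: bnorm_ge0.
have QD x y : Q (x + y) <= Q x + Q y.
  rewrite /Q -big_split /=; apply: ler_sum => i _.
  by rewrite iter_linearD bnormD.
have QZ a x : Q (a *: x) = `|a| * Q x.
  by rewrite /Q mulr_sumr; apply: eq_bigr => i _; rewrite iter_linearZ bnormZ.
have NQ x : N x <= Q x.
  rewrite /Q (bigD1 (Ordinal m_gt0)) //= lerDl.
  by apply: sumr_ge0 => i _; apply: bnorm_ge0.
have QC x : Q x <= C * N x.
  by rewrite /C mulr_suml; apply: ler_sum => i _; apply: bnorm_iter.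
have QT x : Q (T x) = Q x.
  rewrite /Q; case: m m_gt0 Tm {C C_ge0 Q Q_ge0 QD QZ NQ QC} => // p _ Tp.
  rewrite big_ord_recr big_ord_recl /= -iterSr Tp addrC; congr (_ + _).
  by apply: eq_bigr => i _; rewrite -iterSr.
have Q_iter n x : Q (iter n T x) = Q x by elim: n => //= n; rewrite QT.
have Q_sub x y : `|Q y - Q x| <= Q (x - y).
  have h1 := QD (x - y) y; have h2 := QD (y - x) x; rewrite !subrK in h1 h2.
  have h3 : Q (y - x) = Q (x - y).
    by rewrite -[y - x]opprB -[- (x - y)]scaleN1r QZ normrN1 mul1r.
  by rewrite ler_norml; apply/andP; split; lra.
have Q1 x : 0 < 1 + Q x by have := Q_ge0 x; lra.
pose f x := (1 + Q x)^-1 *: x.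
have f1 x : N (f x) <= 1.
  rewrite bnormZ gtr0_norm ?invr_gt0 // mulrC ler_pdivrMr // mul1r.
  by have := NQ x; lra.
have f_lip : blipschitz N (1 + C) f.
  move=> x y.
  have -> : f x - f y =
      (1 + Q x)^-1 *: ((x - y) + (Q y - Q x) *: f y).
    rewrite scalerDr scalerA scalerBr -addrA; congr (_ + _).
    have -> : (1 + Q x)^-1 * (Q y - Q x) = (1 + Q x)^-1 * (1 + Q y) - 1.
      by field; rewrite gt_eqF.
    rewrite scalerBl scale1r -[_ *: f y]scalerA.
    by rewrite [(1 + Q y) *: f y]scalerA divff ?gt_eqF // scale1r addKr.
  rewrite bnormZ gtr0_norm ?invr_gt0 // mulrC ler_pdivrMr //.
  apply: le_trans (bnormD _ _ _) _.
  have h : N ((Q y - Q x) *: f y) <= C * N (x - y).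
    rewrite bnormZ; apply: le_trans (_ : Q (x - y) * 1 <= _).
      by rewrite ler_pM ?bnorm_ge0.
    by rewrite mulr1.
  apply: le_trans (_ : (1 + C) * N (x - y) * 1 <= _).
    by rewrite mulr1 mulrDl mul1r lerD2l.
  rewrite ler_wpM2l ?mulr_ge0 ?bnorm_ge0 //; first by lra.
  by have := Q_ge0 x; lra.
have C1 : 0 < 1 + C by lra.
(* [B * (1 + C)] is both a Lipschitz constant and a bound for [T (f x)], so [g] meets both
   conditions with [k]. *)
have [c c_gt0 cBC] : exists2 c, 0 < c & c * (B * (1 + C)) = k.
  exists (k / (B * (1 + C))); first by rewrite divr_gt0 // mulr_gt0.
  by rewrite divfK // gt_eqF // mulr_gt0.
pose g x := c *: T (f x).
have [||phi [phiT phi1]] := conj g.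
- move=> x y; rewrite /g -scalerBr -[T _ - _]linearB bnormZ gtr0_norm // -cBC -!mulrA.
  rewrite ler_pM2l //; apply: le_trans (TB _) _.
  by rewrite ler_pM2l //; apply: f_lip.
- move=> x; rewrite /g bnormZ gtr0_norm // -cBC ler_pM2l //.
  apply: le_trans (TB _) _; rewrite ler_pM2l //.
  by apply: le_trans (f1 x) _; lra.
pose S x := T x + g x.
have QS x : Q (S x) = Q x + c * (Q x / (1 + Q x)).
  have -> : S x = T ((1 + c / (1 + Q x)) *: x).
    by rewrite /S /g /f linearZ /= scalerA -[X in X + _]scale1r -scalerDl linearZ.
  rewrite QT QZ ger0_norm ?addr_ge0 ?divr_ge0 // ?ltW //.
  by field; rewrite gt_eqF.
have Qv : 0 < Q v by apply: lt_le_trans (NQ v); apply: bnorm_gt0.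
pose delta := c * (Q v / (1 + Q v)).
have delta_gt0 : 0 < delta by rewrite mulr_gt0 ?divr_gt0.
(* Since [t / (1 + t)] increases with [t], each application of [S] along the orbit of [v] adds at
   least [delta] to [Q]. *)
have growth n : Q v + n%:R * delta <= Q (iter n S v).
  elim: n => [|n IH]; first by rewrite mul0r addr0.
  rewrite iterS QS -natr1 mulrDl mul1r addrA lerD // ler_pM2l //.
  rewrite ler_pdivlMr // mulrAC ler_pdivrMr //.
  have : Q v <= Q (iter n S v).
    by apply: le_trans IH; rewrite lerDl mulr_ge0 // ltW.
  lra.
have orbit n : iter n T (phi v) = phi (iter n S v).
  by elim: n => //= n ->; rewrite phiT.
(* [Q (phi (S^n v)) = Q (T^n (phi v)) = Q (phi v)], and the displacement of [phi] has [Q] at most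
   [C]. *)
have bounded n : Q (iter n S v) <= Q (phi v) + C.
  have h1 := QC (phi (iter n S v) - iter n S v).
  have h2 := phi1 (iter n S v).
  have h3 : C * N (phi (iter n S v) - iter n S v) <= C * 1.
    by rewrite ler_wpM2l.
  have := Q_sub (phi (iter n S v)) (iter n S v).
  rewrite -orbit Q_iter orbit ler_norml => /andP[_]; lra.
pose z := (Q (phi v) + C) / delta.
have z_ge0 : 0 <= z by rewrite divr_ge0 ?addr_ge0 // ltW.
have := archi_boundP z_ge0; rewrite /z ltr_pdivrMr // => h.
have := growth (Num.bound z); have := bounded (Num.bound z).
by rewrite -/z in h; lra.
Qed.

(** * Solving [h (s i) - T (h i) = d i] on finite stretches *)

Lemma iter_linear_inj n : injective (iter n T).
Proof. by elim: n => //= n IH x y /(can_inj TK)/IH. Qed.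

(** A coincidence would give [v] a period [j - i <= n], which divides the factorial of [n]. *)
Lemma iter_neq_factorial n (v : V) i j :
  iter n`! T v <> v -> (i < j <= n)%N -> iter i T v <> iter j T v.
Proof.
move=> nv /andP[ij jn] e; apply: nv.
have fixv : iter (j - i) T v = v.
  by apply: (@iter_linear_inj i); rewrite -iterD subnKC // ltnW.
have /dvdnP[q ->] : (j - i %| n`!)%N.
  by rewrite dvdn_fact // subn_gt0 ij (leq_trans (leq_subr _ _)).
by rewrite iterM iter_fix.
Qed.

(** A pseudo-orbit with errors [e *: d j], minus its shadowing orbit and divided by [e], is a
    solution; the bound [1 / e] does not depend on the length [n]. *)
Lemma finite_solvability : exists2 M : R, 0 < M & forall n (d : nat -> V),
  (forall j, N (d j) <= 1) ->
  exists h : nat -> V, (forall j, (j <= n)%N -> N (h j) <= M) /\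
    (forall j, (j < n)%N -> h j.+1 - T (h j) = d j).
Proof.
have [e e0 shad] := separated_shadowing.
exists e^-1; first by rewrite invr_gt0.
move=> n d d1.
(* Either some orbit has its first [n + 1] points distinct, or [T] is torsion and the space is
   trivial. *)
have [[v nv]|tors] := pselect (exists v, iter n`! T v <> v); last first.
  have all0 : forall x : V, x = 0.
    apply: (@stable_torsion_trivial n`!); first exact: fact_gt0.
    by move=> x; apply: contrapT => nx; apply: tors; exists x.
  exists (fun=> 0); split=> j _; first by rewrite bnorm0 invr_ge0 ltW.
  by rewrite (all0 (d j)) linear0 subr0.
pose w := fix w j := if j is i.+1 then T (w i) + e *: d i else 0 : V.
pose W := \sum_(i < n.+1) N (w i).
have wW j : (j <= n)%N -> N (w j) <= W.
  move=> jn; rewrite /W (bigD1 (Ordinal (jn : (j < n.+1)%N))) //= lerDl.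
  by apply: sumr_ge0 => i _; apply: bnorm_ge0.
have W0 : 0 <= W by apply: sumr_ge0 => i _; apply: bnorm_ge0.
pose D i j := N (iter i T v - iter j T v).
(* The sum dominates every ratio needed for separation; its diagonal terms are divisions by 0, hence
   0. *)
pose c := \sum_(p : 'I_n.+1 * 'I_n.+1) (1 + W *+ 2) / D p.1 p.2.
have c_ge0 : 0 <= c.
  by apply: sumr_ge0 => p _; rewrite divr_ge0 ?bnorm_ge0 // addr_ge0 // mulrn_wge0.
have cD i j : (i < j <= n)%N -> 1 + W *+ 2 <= c * D i j.
  move=> ijn; have /andP[ij jn] := ijn.
  have D0 : 0 < D i j.
    by apply: bnorm_gt0; rewrite subr_eq0; apply/eqP/(iter_neq_factorial nv).
  rewrite -ler_pdivrMr //.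
  have i_n : (i < n.+1)%N by rewrite ltnS ltnW // (leq_trans ij).
  rewrite /c (bigD1 (Ordinal i_n, Ordinal (jn : (j < n.+1)%N))) //= lerDl.
  by apply: sumr_ge0 => p _; rewrite divr_ge0 ?bnorm_ge0 // addr_ge0 // mulrn_wge0.
(* Adding an orbit of [T] leaves the errors unchanged, while distances become at least
   [(1 + 2 W) - 2 W = 1]. *)
pose x j := c *: iter j T v + w j.
have xS j : x j.+1 = T (x j) + e *: d j.
  by rewrite /x linearD linearZ /= addrA.
have [||y yx] := shad n x.
- move=> i j ijn; have /andP[ij jn] := ijn; have := cD _ _ ijn.
  have := wW j jn; have := wW i (ltnW (leq_trans ij jn)).
  have -> : c * D i j = N (c *: (iter i T v - iter j T v)).
    by rewrite bnormZ ger0_norm.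
  have -> : c *: (iter i T v - iter j T v) = (x i - x j) - (w i - w j).
    by rewrite /x [- (_ + w j)]opprD addrACA addrK scalerBr.
  have := bnormB N (x i - x j) (w i - w j); have := bnormB N (w i) (w j); lra.
- move=> j jn; rewrite xS addrAC subrr add0r bnormZ gtr0_norm //.
  by rewrite ler_piMr // ltW.
exists (fun j => e^-1 *: (x j - iter j T y)); split => [j jn|j jn].
  rewrite bnormZ gtr0_norm ?invr_gt0 // bnorm_distC.
  by rewrite ler_piMr ?yx ?invr_ge0 ?ltW.
rewrite linearZ /= -scalerBr [T (_ - _)]linearB opprB addrA addrNK xS addrAC subrr add0r.
by rewrite scalerA mulVf ?scale1r // gt_eqF.
Qed.

(** * Solvability on arbitrary index sets *)

(* The average over [t <= n] of the values at [i] of the finite solutions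
   started at [s^-t i] leaves a defect [O(1/n)]. *)
Lemma approximate_solvability : exists2 M : R, 0 < M &
  forall (I : Type) (s p : I -> I) (d : I -> V),
  cancel s p -> cancel p s -> (forall i, N (d i) <= 1) ->
  exists h : I -> V, (forall i, N (h i) <= M) /\
    (forall i, N (d i - (h (s i) - T (h i))) <= 2^-1).
Proof.
have [M M0 finite] := finite_solvability.
exists M => // I s p d sK pK d1.
(* Averaging will divide boundary terms of total size at most [2 M] by [n + 1]. *)
have [n ML] : exists n, M *+ 2 <= 2^-1 * n.+1%:R :> R.
  have M4 : 0 <= M *+ 4 by rewrite mulrn_wge0 // ltW.
  exists (Num.bound (M *+ 4)); have := archi_boundP M4.
  move: (Num.bound _) => n; rewrite -[n.+1%:R]natr1; lra.
have L0 : 0 < n.+1%:R :> R by rewrite ltr0n.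
(* [a i] solves along the stretch that starts at [i]: [a i t] sits over the index [s^t i]. *)
have [a aP] := choice (fun i => finite n.+1 (fun t => d (iter t s i))
  (fun t => d1 (iter t s i))).
have aM i t : (t <= n.+1)%N -> N (a i t) <= M by move=> tn; apply: (aP i).1.
have aS i t : (t < n.+1)%N -> a i t.+1 - T (a i t) = d (iter t s i).
  by move=> tn; apply: (aP i).2.
have iterK t i : iter t s (iter t p i) = i.
  by elim: t => //= t IH; rewrite -iterS iterSr pK.
pose h i := n.+1%:R^-1 *: \sum_(t < n.+1) a (iter t p i) t.
exists h; split=> i.
  rewrite bnormZ gtr0_norm ?invr_gt0 // ler_pdivrMl //.
  apply: le_trans (bnorm_sum _ _ _ _) _.
  apply: (@le_trans _ _ (\sum_(t < n.+1) M)).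
    by apply: ler_sum => t _; rewrite aM // ltnW.
  by rewrite sumr_const card_ord mulr_natl.
(* The sums for [h (s i)] and [T (h i)] cancel except for one term at each end. *)
have -> : d i - (h (s i) - T (h i)) =
    n.+1%:R^-1 *: (a (iter n p i) n.+1 - a (s i) 0%N).
  have e1 : T (\sum_(t < n.+1) a (iter t p i) t) =
      \sum_(t < n.+1) a (iter t p i) t.+1 - d i *+ n.+1.
    rewrite linear_sum -[X in _ *+ X]card_ord -sumr_const -sumrB.
    by apply: eq_bigr => t _; rewrite -[in d i](iterK t i) -aS // opprB addrC subrK.
  have e2 : \sum_(t < n.+1) a (iter t p (s i)) t =
      a (s i) 0%N + \sum_(t < n) a (iter t p i) t.+1.
    rewrite big_ord_recl; congr (_ + _).
    by apply: eq_bigr => t _; rewrite /bump /= -iterS iterSr sK.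
  rewrite /h linearZ /= e1 e2 big_ord_recr /= -scalerBr.
  rewrite -{1}[d i](scalerK (_ : n.+1%:R != 0)) ?gt_eqF // scaler_nat -scalerBr.
  congr (_ *: _).
  set u := \sum_(_ < _) _; set b := a _ n.+1; set c := a (s i) _.
  rewrite opprB addrA [_ + (u + b - _)]addrC subrK [u + b]addrC.
  by rewrite opprD addrACA subrr addr0.
rewrite bnormZ gtr0_norm ?invr_gt0 // ler_pdivrMl // mulrC.
apply: le_trans (bnormB _ _ _) (le_trans _ ML).
by rewrite mulr2n lerD ?aM.
Qed.

(** Each approximate solution halves the defect, so the corrections form a geometric series with sum
    bounded by [2 M]. *)
Lemma uniform_solvability : exists2 M : R, 0 < M &
  forall (I : Type) (s p : I -> I) (d : I -> V),
  cancel s p -> cancel p s -> (forall i, N (d i) <= 1) ->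
  exists h : I -> V, (forall i, N (h i) <= M) /\
    (forall i, h (s i) - T (h i) = d i).
Proof.
have [M M0 approx] := approximate_solvability.
exists (M *+ 2); first by rewrite mulrn_wgt0.
move=> I s p d sK pK d1.
pose A (h : I -> V) i := h (s i) - T (h i).
(* The bound is a premise so that choice yields a corrector [F] defined for every [d']; outside the
   unit ball [d'] itself is a default value. *)
have step_ex d' : exists h, (forall i, N (d' i) <= 1) ->
    (forall i, N (h i) <= M) /\ (forall i, N (d' i - A h i) <= 2^-1).
  have [d'1|nd] := pselect (forall i, N (d' i) <= 1).
    by have [h hP] := approx _ _ _ _ sK pK d'1; exists h.
  by exists d'.
have [F FP] := choice step_ex.
(* Doubling brings the remaining defect back into the unit ball. *)
pose step (d : I -> V) i := 2 *: (d i - A (F d) i).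
pose e n := iter n step d.
have e1 n i : N (e n i) <= 1.
  elim: n i => [//|n IH] i; rewrite /e /= -/(e n) /step bnormZ.
  by have := (FP _ IH).2 i; rewrite ger0_norm //; lra.
pose H n i := \sum_(k < n) (2^-1 ^+ k) *: F (e k) i.
have HS n i : H n.+1 i = H n i + (2^-1 ^+ n) *: F (e n) i.
  by rewrite /H big_ord_recr.
have AH n i : d i - A (H n) i = (2^-1 ^+ n) *: e n i.
  elim: n => [|n IH].
    by rewrite /A /H !big_ord0 linear0 !subr0 scale1r.
  have -> : A (H n.+1) i = A (H n) i + (2^-1 ^+ n) *: A (F (e n)) i.
    rewrite /A !HS linearD opprD addrACA; congr (_ + _).
    by rewrite linearZ /= scalerBr.
  rewrite opprD addrA IH -scalerBr exprSr -scalerA {2}/e /= -/(e n) /step.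
  by rewrite [2^-1 *: _]scalerA mulVf ?pnatr_eq0 // scale1r.
have H_cauchy i n : N (H n.+1 i - H n i) <= M / 2 ^+ n.
  rewrite HS addrC addKr bnormZ ger0_norm ?exprn_ge0 // exprVn mulrC.
  by rewrite ler_pM2r ?invr_gt0 ?exprn_gt0 //; apply: (FP _ (e1 n)).1.
have [h hP] := choice (fun i => bnorm_complete (H_cauchy i)).
exists h; split=> i.
  by have := hP i 0%N; rewrite /H big_ord0 subr0 expr0 divr1.
apply/subr0_eq/(bnorm_eq0 (b := N))/le_anti; rewrite bnorm_ge0 andbT.
apply: (@le0_geometric _ _ ((1 + B) * (M *+ 2) + 1)) => n.
(* [h] differs from [H n] by [O(2^-n)], and the defect of [H n] is [2^-n] times a vector of norm at
   most 1. *)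
have -> : h (s i) - T (h i) - d i = (h (s i) - H n (s i)) -
    (T (h i - H n i) + (2^-1 ^+ n) *: e n i).
  rewrite -AH /A linearB; set x := h _; set y := T (h i); set z := H n _.
  set w := T _; rewrite opprB [y - w + _]addrCA [y - w + _]addrA subrK.
  by rewrite [d i + _]addrA opprB addrA subrK [d i + _]addrC opprD addrA.
apply: le_trans (bnormB _ _ _) _.
have h1 := hP (s i) n; have h2 := TB (h i - H n i).
have h3 : B * N (h i - H n i) <= B * (M *+ 2 / 2 ^+ n) by rewrite ler_pM2l.
have h4 : N ((2^-1 ^+ n) *: e n i) <= 1 / 2 ^+ n.
  rewrite bnormZ ger0_norm ?exprn_ge0 // exprVn mulrC.
  by rewrite ler_pM2r ?invr_gt0 ?exprn_gt0.
have h5 := bnormD N (T (h i - H n i)) ((2^-1 ^+ n) *: e n i).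
rewrite !mulrDl mul1r -mulrA; lra.
Qed.

(** The errors of [x] divided by [r] are admissible data; if [h] solves for them, [x + r h]
    satisfies the orbit equation. *)
Lemma corrected_pseudo_orbit : exists2 M : R, 0 < M &
  forall (r : R) (I : Type) (s p : I -> I) (x : I -> V), 0 < r ->
  cancel s p -> cancel p s -> (forall i, N (T (x i) - x (s i)) <= r) ->
  exists y : I -> V, (forall i, y (s i) = T (y i)) /\
    (forall i, N (x i - y i) <= r * M).
Proof.
have [M M0 solve] := uniform_solvability.
exists M => // r I s p x r0 sK pK xr.
have [|h [hM hE]] := solve I s p (fun i => r^-1 *: (T (x i) - x (s i))) sK pK.
  by move=> i; rewrite bnormZ gtr0_norm ?invr_gt0 // ler_pdivrMl // mulr1.
exists (fun i => x i + r *: h i); split=> i; last first.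
  rewrite opprD addrA subrr add0r bnormN bnormZ gtr0_norm //.
  by rewrite ler_pM2l.
rewrite linearD linearZ /= -[h (s i)](subrK (T (h i))) hE scalerDr scalerA.
by rewrite divff ?gt_eqF // scale1r [x (s i) + _]addrA [x (s i) + _]addrC subrK.
Qed.

End StableOperator.

(** * Restriction of scalars along a ring morphism *)

(* [iota] only serves to select the [R]-module structure put on [X]. *)
Definition restrict_scalars (R K : nzRingType) (iota : {rmorphism R -> K})
  (X : lmodType K) : Type := X.

Section RestrictScalars.
Context (R K : nzRingType) (iota : {rmorphism R -> K}) (X : lmodType K).
Local Notation V := (restrict_scalars iota X).

HB.instance Definition _ := GRing.Zmodule.copy V X.

Definition restricted_scale (a : R) (x : V) : V := iota a *: (x : X).

Lemma restricted_scaleA a b x :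
  restricted_scale a (restricted_scale b x) = restricted_scale (a * b) x.
Proof. by rewrite /restricted_scale scalerA rmorphM. Qed.

Lemma restricted_scale1 : left_id 1 restricted_scale.
Proof. by move=> x; rewrite /restricted_scale rmorph1 scale1r. Qed.

Lemma restricted_scaleDr : right_distributive restricted_scale +%R.
Proof. by move=> a x y; apply: scalerDr. Qed.

Lemma restricted_scaleDl x :
  {morph restricted_scale^~ x : a b / a + b}.
Proof. by move=> a b; rewrite /restricted_scale rmorphD scalerDl. Qed.

HB.instance Definition _ := GRing.Zmodule_isLmodule.Build R V
  restricted_scaleA restricted_scale1 restricted_scaleDr restricted_scaleDl.

Definition restricted_op (f : X -> X) : V -> V := f.

Lemma restricted_op_linear (f : {linear X -> X}) :
  linear (restricted_op f).
Proof. by move=> a x y; apply: (linearP f (iota a)). Qed.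

HB.instance Definition _ (f : {linear X -> X}) :=
  GRing.isLinear.Build R V V _ (restricted_op f) (restricted_op_linear f).

End RestrictScalars.

(** * The real-valued norm of a Banach space over [K] *)

Section RestrictedNorm.
Context (R : realType) (K : numFieldType) (iota : {rmorphism R -> K}).
Context (re : K -> R) (iota_le : {mono iota : a b / a <= b}).
Context (iota_re : forall z : K, 0 <= z -> iota (re z) = z).
Context (X : completeNormedModType K).
Local Notation V := (restrict_scalars iota X).

Definition restricted_norm (x : V) : R := re `|x : X|.

Lemma iota_restricted_norm (x : V) : iota (restricted_norm x) = `|x : X|.
Proof. by rewrite iota_re. Qed.

Lemma iota_lt : {mono iota : a b / a < b}.
Proof. exact: leW_mono. Qed.

Lemma iota_norm a : `|iota a| = iota `|a|.
Proof.
case: (leP 0 a) => a0; first by rewrite !ger0_norm // -(rmorph0 iota) iota_le.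
by rewrite !ltr0_norm ?rmorphN // -(rmorph0 iota) iota_lt.
Qed.

Lemma restricted_normD x y :
  restricted_norm (x + y) <= restricted_norm x + restricted_norm y.
Proof. by rewrite -iota_le rmorphD !iota_restricted_norm ler_normD. Qed.

Lemma restricted_normZ a x :
  restricted_norm (a *: x) = `|a| * restricted_norm x.
Proof.
apply: (fmorph_inj iota).
by rewrite rmorphM !iota_restricted_norm normrZ iota_norm.
Qed.

Lemma restricted_norm_eq0 x : restricted_norm x = 0 -> x = 0.
Proof.
by move=> x0; apply: normr0_eq0; rewrite -iota_restricted_norm x0 rmorph0.
Qed.

Lemma nbhs0_restricted_norm (U : set X) :
  nbhs (0 : X) U <->
  exists2 e, 0 < e & forall x : V, restricted_norm x < e -> U x.
Proof.
split=> [/nbhs_normP[e /= e0 eU]|[e e0 eU]].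
  exists (re e); first by rewrite -iota_lt rmorph0 iota_re // ltW.
  move=> x; rewrite -iota_lt iota_restricted_norm iota_re ?ltW // => xe.
  by apply: eU; rewrite /= sub0r normrN.
apply/nbhs_normP; exists (iota e); first by rewrite /= -(rmorph0 iota) iota_lt.
move=> x; rewrite /= sub0r normrN => xe; apply: eU.
by rewrite -iota_lt iota_restricted_norm.
Qed.

Lemma restricted_norm_complete (u : nat -> V) (C : R) :
  (forall n, restricted_norm (u n.+1 - u n) <= C / 2 ^+ n) ->
  exists l, forall n, restricted_norm (l - u n) <= C *+ 2 / 2 ^+ n.
Proof.
move=> uC.
(* Subtracting the tail makes the induction telescope: [2 C / 2^n - 2 C / 2^(n+1) = C / 2^n]. *)
have u_dist n k :
    restricted_norm (u (k + n)%N - u n) <= C *+ 2 / 2 ^+ n - C *+ 2 / 2 ^+ (k + n).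
  elim: k => [|k IH].
    by rewrite add0n !subrr /restricted_norm normr0 -iota_le iota_re ?rmorph0.
  have -> : u (k.+1 + n)%N - u n =
      (u (k + n).+1 - u (k + n)%N) + (u (k + n)%N - u n).
    by rewrite addrA subrK.
  apply: le_trans (restricted_normD _ _) _.
  have := uC (k + n)%N; rewrite addSn exprS invfM mulrA -[C *+ 2]mulr_natr.
  rewrite mulfK ?pnatr_eq0 //; lra.
have C0 : 0 <= C.
  have := uC 0%N; rewrite expr0 divr1; apply: le_trans.
  by rewrite -iota_le rmorph0 iota_restricted_norm.
have u_le n m : (n <= m)%N -> restricted_norm (u m - u n) <= C *+ 2 / 2 ^+ n.
  move=> /subnK <-; apply: le_trans (u_dist _ _) _.
  by rewrite lerBlDr lerDl divr_ge0 ?mulrn_wge0 ?exprn_ge0.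
have small (e : R) : 0 < e -> exists n, C *+ 2 / 2 ^+ n < e.
  move=> e0; apply: contrapT => nex.
  suff : e <= 0 by rewrite leNgt e0.
  apply: (@le0_geometric _ _ (C *+ 2)) => n; rewrite leNgt; apply/negP => ?.
  by apply: nex; exists n.
have : cauchy ((u : nat -> X) @ \oo).
  apply: cauchy_exP => e e0.
  have e'0 : 0 < re e by rewrite -iota_lt rmorph0 iota_re // ltW.
  have [n nP] := small _ e'0; exists (u n).
  exists n => // m /= nm; rewrite -ball_normE /= distrC.
  rewrite -iota_restricted_norm -[e]iota_re ?ltW // iota_lt.
  exact: le_lt_trans (u_le _ _ nm) nP.
move=> /cauchy_cvg/cvg_ex[l /= ul]; pose y : V := l; exists y => n.
apply/ler_addgt0Pr => e e0.
have e'0 : 0 < iota e by rewrite -(rmorph0 iota) iota_lt.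
have /cvgrPdist_lt/(_ _ e'0)[m _ um] := ul.
have h1 : restricted_norm (y - u (maxn m n)) < e.
  by rewrite -iota_lt iota_restricted_norm; apply: um; apply: leq_maxl.
have h2 := u_le _ _ (leq_maxr m n).
have -> : y - u n = (y - u (maxn m n)) + (u (maxn m n) - u n).
  by rewrite addrA subrK.
have := restricted_normD (y - u (maxn m n)) (u (maxn m n) - u n); lra.
Qed.

Definition restricted_banach_norm : banach_norm V :=
  BanachNorm restricted_normD restricted_normZ restricted_norm_eq0
    restricted_norm_complete.
Local Notation N := restricted_banach_norm.

Lemma blipschitz_continuous (L : R) (f : X -> X) :
  blipschitz N L f -> continuous f.
Proof.
move=> fL x; apply/cvgrPdist_lt => e e0.
have e'0 : 0 < re e by rewrite -iota_lt rmorph0 iota_re // ltW.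
have d0 : 0 < re e / (`|L| + 1) by rewrite divr_gt0 // ltr_wpDl.
have id0 : 0 < iota (re e / (`|L| + 1)) by rewrite -(rmorph0 iota) iota_lt.
have /cvgrPdist_lt/(_ _ id0) : y @[y --> x] --> x by [].
apply: filterS => y.
have -> : `|x - y| = iota (N (x - y)) by rewrite iota_restricted_norm.
have -> : `|f x - f y| = iota (N (f x - f y)) by rewrite iota_restricted_norm.
rewrite -[e in _ -> _ < e]iota_re ?ltW // !iota_lt ltr_pdivlMr ?ltr_wpDl // => h.
apply: le_lt_trans (fL x y) (le_lt_trans _ h); rewrite mulrC ler_wpM2l //.
  exact: bnorm_ge0.
by have := ler_norm L; lra.
Qed.

Lemma linear_continuous_bounded (f : X -> X) : linear f -> continuous f ->
  exists2 B : R, 0 < B & forall x : V, N (f x) <= B * N x.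
Proof.
move=> f_lin f_cont.
have f0 : f 0 = 0.
  have := f_lin (-1) 0 0; rewrite !scaleN1r oppr0 addr0 => ->.
  by rewrite addNr.
have : nbhs (0 : X) (f @^-1` [set y | restricted_norm y < 1]).
  apply: f_cont; rewrite f0; apply/nbhs0_restricted_norm.
  by exists 1.
move=> /nbhs0_restricted_norm[e e0 fe]; exists (2 / e) => [|x].
  by rewrite divr_gt0.
have [->|x0] := eqVneq x 0; first by rewrite f0 bnorm0 mulr0.
have Nx : 0 < N x by apply: bnorm_gt0.
(* The scaled vector has norm [e / 2], inside the ball where [f] is bounded by 1. *)
pose a := e / 2 / N x.
have a0 : 0 < a by rewrite !divr_gt0.
have : restricted_norm (f (iota a *: x)) < 1.
  apply: fe; have := restricted_normZ a x; rewrite gtr0_norm // => ->.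
  by rewrite divfK ?gt_eqF //; lra.
have -> : f (iota a *: x) = iota a *: f x.
  by have := f_lin (iota a) x 0; rewrite f0 !addr0.
have := restricted_normZ a (f x); rewrite gtr0_norm // => -> /ltW.
rewrite -ler_pdivlMl // mulr1 => /le_trans; apply.
by rewrite /a !invf_div mulrC lexx.
Qed.

(** * Shadowing properties of topologically stable operators *)

Section Operator.
Context (T : GL X).

Lemma GL_inv_linear : linear (GL_inv T).
Proof.
move=> a x y; apply: (can_inj (GL_opK T)).
by rewrite GL_invK linearP !GL_invK.
Qed.

Lemma topologically_stable_lipschitz :
  topologically_stable T -> lipschitz_stable N T.
Proof.
move=> /(_ [set x | restricted_norm x < 1]) [|U [/nbhs0_restricted_norm]].
  by apply/nbhs0_restricted_norm; exists 1.
move=> [e e0 eU] stab; exists (e / 2); first by rewrite divr_gt0.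
move=> S S' L SK S'K SL S'L TS.
have [||phi [_ phiT phi1]] := stab S.
- split; first exact: blipschitz_continuous SL.
  by exists S'; split => //; apply: blipschitz_continuous S'L.
- by move=> x; apply: eU; apply: le_lt_trans (TS x) _; lra.
- by exists phi; split => // x; apply/ltW/phi1.
Qed.

Context (T_stable : topologically_stable T).

(** Continuity of [T] and of its inverse provides the two-sided bound [B] required on the underlying
    real space. *)
Lemma stable_corrected_pseudo_orbit : exists2 M : R, 0 < M &
  forall (r : R) (I : Type) (s p : I -> I) (x : I -> X), 0 < r ->
  cancel s p -> cancel p s ->
  (forall i, restricted_norm (T (x i) - x (s i)) <= r) ->
  exists y : I -> X, (forall i, y (s i) = T (y i)) /\
    (forall i, restricted_norm (x i - y i) <= r * M).
Proof.
have [B1 B1_gt0 TB] := linear_continuous_bounded (@linearP _ _ _ _ T)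
  (@GL_continuous _ _ T).
have [B2 B2_gt0 TiB] := linear_continuous_bounded GL_inv_linear
  (@GL_inv_continuous _ _ T).
pose B := Num.max B1 B2.
have B_gt0 : 0 < B by rewrite lt_max B1_gt0.
have TB' (x : V) : N (restricted_op (iota := iota) T x) <= B * N x.
  by apply: le_trans (TB x) _; rewrite ler_wpM2r ?bnorm_ge0 // le_max lexx.
have TiB' (x : V) : N x <= B * N (restricted_op (iota := iota) T x).
  have := TiB (T x); rewrite GL_opK => /le_trans; apply.
  by rewrite ler_wpM2r ?bnorm_ge0 // le_max lexx orbT.
have := corrected_pseudo_orbit
  (T := restricted_op (iota := iota) T : {linear V -> V}) (@GL_opK _ _ T)
  (@GL_invK _ _ T) B_gt0 TB' TiB' (topologically_stable_lipschitz T_stable).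
exact.
Qed.

Lemma orbit_of_recurrence (y : nat -> X) :
  (forall j, y j.+1 = T (y j)) -> forall j, y j = iter j T (y 0%N).
Proof. by move=> yT; elim=> // j IH; rewrite yT IH. Qed.

Lemma stable_shadowing : shadowing_property T.
Proof.
have [M M0 correct] := stable_corrected_pseudo_orbit.
move=> W /nbhs0_restricted_norm[e e0 eW].
(* This radius makes the correction at most [e / 2], strictly below [e]. *)
have r0 : 0 < e / 2 / M by rewrite !divr_gt0.
exists [set x | restricted_norm x < e / 2 / M]; split.
  by apply/nbhs0_restricted_norm; exists (e / 2 / M).
move=> x_ xr.
have [y [yT xy]] := correct _ int (fun j => j + 1) (fun j => j - 1) x_ r0
  (addrK _) (subrK _) (fun j => ltW (xr j)).
have y_orbit j : y j = GL_iterz T j (y 0).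
  case: j => n.
    apply: (@orbit_of_recurrence (fun n => y (Posz n))) => j.
    by rewrite -yT -addn1 PoszD.
  (* At negative indices the recurrence is run backwards through [GL_inv T]. *)
  rewrite /GL_iterz NegzE; elim: (n.+1) => [|q IH]; first by rewrite oppr0.
  rewrite /= -IH -[in RHS](subrK 1 (- q%:Z)) yT GL_opK.
  by rewrite -addn1 PoszD opprD.
exists (y 0) => j; rewrite -y_orbit; apply: eW.
apply: le_lt_trans (xy j) _; rewrite divfK ?gt_eqF //; lra.
Qed.

(** On a cycle of length [k] the correction yields a cyclic orbit of [T], whose starting point is
    therefore fixed by [T^k]. *)
Lemma stable_periodic_shadowing : strict_periodic_shadowing_property T.
Proof.
have [M M0 correct] := stable_corrected_pseudo_orbit.
move=> W /nbhs0_restricted_norm[e e0 eW].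
have r0 : 0 < e / 2 / M by rewrite !divr_gt0.
exists [set x | restricted_norm x < e / 2 / M]; split.
  by apply/nbhs0_restricted_norm; exists (e / 2 / M).
move=> x_ k k0 x_per xr.
have x_mod j : x_ (j %% k)%N = x_ j.
  rewrite [in RHS](divn_eq j k); elim: (j %/ k)%N => [|q IH].
    by rewrite mul0n.
  by rewrite mulSn -addnA addnC x_per.
have [|y [yT xy]] := correct _ 'I_k (@ordS k) (@ord_pred k)
    (fun i => x_ i) r0 (@ordSK k) (@ord_predK k).
  by move=> i /=; rewrite x_mod; apply/ltW/xr.
(* [z] unrolls the cyclic orbit over the natural numbers. *)
pose z j := y (Ordinal (ltn_pmod j k0)).
have z_orbit : forall j, z j = iter j T (z 0%N).
  apply: orbit_of_recurrence => j; rewrite /z -yT; congr y.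
  by apply: val_inj; rewrite /= -addn1 -[in RHS]addn1 modnDml.
exists (z 0%N); split=> [|j].
  by rewrite -z_orbit /z; congr y; apply: val_inj; rewrite /= modnn mod0n.
rewrite -z_orbit -(x_mod j); apply: eW.
by apply: le_lt_trans (xy (Ordinal (ltn_pmod j k0))) _; rewrite divfK ?gt_eqF //; lra.
Qed.

End Operator.
End RestrictedNorm.

(** * Real and complex scalars *)

Theorem corollary15 (R : realType) :
  (forall (X : completeNormedModType R) (T : GL X),
     topologically_stable T ->
     shadowing_property T /\ strict_periodic_shadowing_property T) /\
  (forall (X : completeNormedModType (complex R)) (T : GL X),
     topologically_stable T ->
     shadowing_property T /\ strict_periodic_shadowing_property T).
Proof.
split=> X T T_stable.
  have id_le : {mono (idfun : {rmorphism R -> R}) : a b / a <= b} by [].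
  have id_re (z : R) : 0 <= z -> (idfun : {rmorphism R -> R}) (idfun z) = z by [].
  split; first exact: (stable_shadowing id_le id_re).
  exact: (stable_periodic_shadowing id_le id_re).
have iota_le : {mono (real_complex R : {rmorphism R -> complex R}) :
    a b / a <= b} by move=> a b; apply: lecR.
(* A nonnegative complex number is real, so its real part recovers it. *)
have iota_re (z : complex R) : 0 <= z -> real_complex R (complex.Re z) = z.
  by move=> z0; apply/eqP; rewrite RRe_real ?ger0_real.
split; first exact: (stable_shadowing iota_le iota_re).
exact: (stable_periodic_shadowing iota_le iota_re).
Qed.
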